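(* Let $G$ be a graph of order $n$ such that $G\neq K_n$ and $G$ has at least one vertex of degree $n-1$. Then $SC(G)=0$ (that is, $G$ has no strong coalition partition).
   Context: Graphs are finite, simple and undirected, with nonempty vertex set $V(G)$; the order is $n=|V(G)|$. $K_n$ is the complete graph of order $n$. A set $D\subseteq V(G)$ is a strong dominating set of $G$ if for every $x\in V(G)\setminus D$ there is $y\in D$ with $xy\in E(G)$ and $\deg(x)\le\deg(y)$. Two disjoint sets $V_1,V_2\subseteq V(G)$ form a strong coalition if neither is a strong dominating set but $V_1\cup V_2$ is a strong dominating set. A strong coalition partition of $G$ is a partition $\Omega=\{V_1,\dots,V_k\}$ of $V(G)$ into nonempty sets such that each $V_i$ either is a strong dominating set consisting of a single vertex of degree $n-1$, or is not a strong dominating set but forms a strong coalition with another set $V_j\in\Omega$ that is not a strong dominating set. The strong coalition number $SC(G)$ is the maximum cardinality of a strong coalition partition of $G$, with $SC(G)=0$ if $G$ has no strong coalition partition. *)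

(* Defs.v *)
From HB Require Import structures.
From mathcomp Require Import all_boot.

Set Implicit Arguments.
Unset Strict Implicit.
Unset Printing Implicit Defensive.

Record sgraph := SGraph {
  vertex :> finType;
  edge : rel vertex;
  edge_sym : symmetric edge;
  edge_irr : irreflexive edge;
  order_gt0 : 0 < #|vertex|
}.

Section StrongCoalition.
Variable G : sgraph.
Implicit Types (x y : G) (A B D : {set G}) (Omega : {set {set G}}).

Definition deg x : nat := #|[set y | edge x y]|.

(* [complete] says that G is K_n for n := #|G|. *)
Definition complete : bool :=
  [forall x : G, forall y : G, (x != y) ==> edge x y].

Definition strong_dominating D : bool :=
  [forall x in ~: D, exists y in D, edge x y && (deg x <= deg y)].

Definition strong_coalition A B : bool :=
  [&& [disjoint A & B],
      ~~ strong_dominating A,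
      ~~ strong_dominating B
    & strong_dominating (A :|: B)].

Definition strong_coalition_partition Omega : bool :=
  partition Omega [set: G] &&
  [forall A in Omega,
     (strong_dominating A &&
        [exists x : G, (A == [set x]) && (deg x == #|G|.-1)])
     || (~~ strong_dominating A &&
        [exists B in Omega,
           [&& B != A, ~~ strong_dominating B & strong_coalition A B]])].

(* The maximum over an empty family is 0, which is the convention for graphs
   without a strong coalition partition. *)
Definition SC : nat :=
  \max_(Omega : {set {set G}} | strong_coalition_partition Omega) #|Omega|.

End StrongCoalition.

Arguments complete : clear implicits.
Arguments SC : clear implicits.

(* Main.v *)
Require Import Defs.
From mathcomp Require Import all_boot.

(** Call a vertex full when its degree is [#|G|.-1], the largest possible one.
    If [G] has a full vertex, then a set is strong dominating exactly when it
    contains a full vertex ([strong_dominatingE]): a full vertex dominates every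
    other vertex, and a full vertex outside the set can only be dominated by a
    vertex of the same degree. Meeting the set of full vertices passes from a
    union to one of its two terms, so no strong coalition exists
    ([no_strong_coalition]). Hence every class of a strong coalition partition
    is a singleton consisting of a full vertex. As the classes cover [G], all
    vertices are full and [G] is complete. *)

Section FullVertices.
Variable G : sgraph.
Implicit Types (x y v : G) (A B D : {set G}) (Omega : {set {set G}}).

Lemma neighbors_sub x : [set y | edge x y] \subset [set~ x].
Proof.
by apply/subsetP=> y; rewrite !inE; apply: contraTneq => ->; rewrite edge_irr.
Qed.

Lemma deg_max x : deg x <= #|G|.-1.
Proof. by rewrite -(cardsC1 x) subset_leq_card ?neighbors_sub. Qed.

Lemma full_edge v x : deg v = #|G|.-1 -> v != x -> edge v x.
Proof.
move=> full_v neq_vx.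
have /eqP/setP/(_ x) : [set y | edge v y] == [set~ v].
  by rewrite eqEcard neighbors_sub cardsC1 -full_v leqnn.
by rewrite !inE eq_sym neq_vx.
Qed.

Lemma full_strong_dominating D v :
  v \in D -> deg v = #|G|.-1 -> strong_dominating D.
Proof.
move=> Dv full_v; apply/'forall_in_existsP=> x; rewrite inE => notDx.
exists v; rewrite Dv edge_sym full_edge ?full_v ?deg_max //.
by apply: contraNneq notDx => <-.
Qed.

Lemma strong_dominatingE D :
  (exists v, deg v = #|G|.-1) ->
  strong_dominating D = [exists v in D, deg v == #|G|.-1].
Proof.
case=> v full_v; apply/idP/exists_inP=> [domD | [w Dw /eqP]]; last first.
  exact: full_strong_dominating.
have [Dv | notDv] := boolP (v \in D); first by exists v; rewrite ?full_v.
have /exists_inP[y Dy /andP[_ le_vy]] : [exists y in D, edge v y && (deg v <= deg y)].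
  by move/forall_inP: domD; apply; rewrite inE.
by exists y; rewrite // eqn_leq deg_max -full_v.
Qed.

Lemma no_strong_coalition A B :
  (exists v, deg v = #|G|.-1) -> ~~ strong_coalition A B.
Proof.
move=> exfull; apply/negP; case/and4P=> _ notA notB.
rewrite strong_dominatingE // => /exists_inP[v /setUP[Av | Bv] /eqP full_v].
  by rewrite (full_strong_dominating _ _ Av full_v) in notA.
by rewrite (full_strong_dominating _ _ Bv full_v) in notB.
Qed.

Lemma strong_coalition_partition_complete Omega :
  (exists v, deg v = #|G|.-1) ->
  strong_coalition_partition Omega -> complete G.
Proof.
move=> exfull /andP[/and3P[/eqP coverG _ _] /forall_inP OmegaP].
have all_full x : deg x = #|G|.-1.
  have /bigcupP[A OmA Ax] : x \in cover Omega by rewrite coverG inE.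
  case/orP: (OmegaP A OmA) => /andP[_].
    case/existsP=> v /andP[/eqP defA /eqP full_v].
    by move: Ax; rewrite defA => /set1P->.
  case/exists_inP=> B _ /and3P[_ _ coalAB].
  by rewrite (negPf (no_strong_coalition A B exfull)) in coalAB.
apply/forallP=> x; apply/forallP=> y; apply/implyP.
exact/full_edge/all_full.
Qed.

End FullVertices.

Theorem proposition2p3 (G : sgraph) (n : nat) (order_G : #|G| = n)
    (G_neq_Kn : ~~ complete G)
    (has_full : exists v : G, deg v = n.-1) :
  SC G = 0 /\
  ~ (exists Omega : {set {set G}}, strong_coalition_partition Omega).
Proof.
have no_part (Omega : {set {set G}}) : ~~ strong_coalition_partition Omega.
  apply: contra G_neq_Kn; apply: strong_coalition_partition_complete.
  by rewrite order_G.
split; last by case=> Omega; apply/negP.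
by apply: big_pred0 => Omega; exact: negPf (no_part Omega).
Qed.
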